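(* Let $A\in\mathbb{R}^{n\times n}$ be fixed and let $B_1,\dots,B_n$ be generated from $B_0\in\mathbb{R}^{n\times n}$ by one of the three update rules in the context (Broyden family, generalized PSB family, BGM), using nonzero directions $s_0,\dots,s_{n-1}\in\mathbb{R}^n$ and $y_k=As_k$. Suppose $$s_k\in\operatorname{span}\{s_0,s_1,\dots,s_{k-1}\}^{\perp_W},\qquad k=1,\dots,n-1,$$ where $W$ is the symmetric positive definite matrix associated with the update rule as follows: (i) Broyden family: $W=A$ at every step, or $W=B_k$ at every step $k$; (ii) generalized PSB family with symmetric nonsingular parameter matrix $M$: $W=M^{-2}$; (iii) BGM: $W=I$. Then the process terminates in at most $n$ steps, i.e. $B_n=A$.
   Context: For a symmetric positive definite $W\in\mathbb{R}^{n\times n}$ put $\langle a,b\rangle_W=a^\top W b$; for a subspace $V$, $V^{\perp_W}=\{z\in\mathbb{R}^n: \langle z,x\rangle_W=0\ \forall x\in V\}$. In the choices $W=A$ or $W=B_k$ these matrices are understood to be symmetric positive definite. Matrix approximation process: at step $k$ one takes $s_k\in\mathbb{R}^n\setminus\{0\}$, sets $y_k=As_k$, and computes $B_{k+1}$ from $B_k$, so that $B_{k+1}s_k=y_k$, by one of the following rules. Broyden family (fixed real parameter $\theta$; $A$ and all $B_k$ symmetric): $$B_{k+1}=B_k+\frac{y_ky_k^\top}{s_k^\top y_k}-\frac{B_ks_ks_k^\top B_k}{s_k^\top B_ks_k}+\theta\,\omega_k\omega_k^\top,\qquad \omega_k=\sqrt{s_k^\top B_ks_k}\left(\frac{y_k}{s_k^\top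 y_k}-\frac{B_ks_k}{s_k^\top B_ks_k}\right),$$ where the update is assumed well defined ($s_k^\top y_k\ne0$, $s_k^\top B_ks_k>0$). Generalized PSB family (fixed symmetric nonsingular $M\in\mathbb{R}^{n\times n}$; $A$ and all $B_k$ symmetric): with $r_k=y_k-B_ks_k$, $$B_{k+1}=B_k+\frac{r_ks_k^\top M^{-2}+M^{-2}s_kr_k^\top}{s_k^\top M^{-2}s_k}-\frac{s_k^\top r_k}{(s_k^\top M^{-2}s_k)^2}M^{-2}s_ks_k^\top M^{-2}.$$ BGM (Broyden's ''good'' method; no symmetry of $A$ or $B_k$ required): $$B_{k+1}=B_k+\frac{(y_k-B_ks_k)s_k^\top}{s_k^\top s_k}.$$ *)

(* Defs.v *)
From mathcomp Require Import all_boot all_order all_algebra.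
From mathcomp Require Import reals.

Set Implicit Arguments.
Unset Strict Implicit.
Unset Printing Implicit Defensive.

Import Order.TTheory GRing.Theory Num.Theory.

Local Open Scope ring_scope.

Section Defs.
Variables (R : realType) (n : nat).
Implicit Types (A B M W : 'M[R]_n) (s y r a b z : 'cV[R]_n).
Implicit Type V : {vspace 'cV[R]_n}.

Definition dot a b : R := (a^T *m b) 0 0.

Definition dotW W a b : R := (a^T *m W *m b) 0 0.

Definition spd W : Prop :=
  W \is symmetricmx /\ forall z, z != 0 -> 0 < dotW W z z.

Definition orthcomp W V z : Prop := forall x, x \in V -> dotW W z x = 0.

Definition span_before (s : nat -> 'cV[R]_n) (k : nat) : {vspace 'cV[R]_n} :=
  <<[seq s j | j <- iota 0 k]>>%VS.

Definition omega B s y : 'cV[R]_n :=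
  Num.sqrt (dotW B s s) *: ((dot s y)^-1 *: y - (dotW B s s)^-1 *: (B *m s)).

Definition broyden_update (theta : R) B s y : 'M[R]_n :=
  B + (dot s y)^-1 *: (y *m y^T)
    - (dotW B s s)^-1 *: (B *m s *m s^T *m B)
    + theta *: (omega B s y *m (omega B s y)^T).

Definition invmx2 M : 'M[R]_n := invmx M *m invmx M.

Definition gpsb_update M B s y : 'M[R]_n :=
  let N := invmx2 M in
  let r := y - B *m s in
  B + (dotW N s s)^-1 *: (r *m s^T *m N + N *m s *m r^T)
    - (dot s r / dotW N s s ^+ 2) *: (N *m s *m s^T *m N).

Definition bgm_update B s y : 'M[R]_n :=
  B + (dot s s)^-1 *: ((y - B *m s) *m s^T).

End Defs.

(* Main.v *)
(* Conjugacy of [s k] with the earlier directions makes the correction terms of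
   the update vanish on them, so by induction [B k] agrees with [A] on
   [s 0, ..., s k.-1]; after n steps the directions form a basis.  When the
   conjugacy is with respect to [B k], the induction hypothesis
   [B k *m s j = A *m s j] turns it into conjugacy with respect to [A]; the
   directions are then independent because [s k]^T [A] [s k] is nonzero, even
   though [A] need not be definite. *)
Require Import Defs.
From mathcomp Require Import all_boot all_order all_algebra.
From mathcomp Require Import reals.

Set Implicit Arguments.
Unset Strict Implicit.

Import Order.TTheory GRing.Theory Num.Theory.
Local Open Scope ring_scope.

Lemma symmetricmx_tr (R : fieldType) (n : nat) (A : 'M[R]_n) :
  A \is symmetricmx -> A^T = A.
Proof.
rewrite qualifE /= expr0 scale1r => /eqP {2}->.
by apply/matrixP=> i j; rewrite !mxE.
Qed.

(* If [S] has columns [s 0, ..., s n.-1], the Gram matrix [S^T N S] is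
   triangular with nonzero diagonal, so [S] is invertible. *)
Lemma eq_mx_conjugate (F : fieldType) (n : nat) (N A B : 'M[F]_n)
    (s : nat -> 'cV[F]_n) :
    (forall j k, (j < k < n)%N -> ((s k)^T *m N *m s j) 0 0 = 0) ->
    (forall k, (k < n)%N -> ((s k)^T *m N *m s k) 0 0 != 0) ->
    (forall k, (k < n)%N -> B *m s k = A *m s k) ->
  B = A.
Proof.
move=> conj0 diag_neq0 eqBA; pose S := \matrix_(i < n, j < n) s j i 0.
have mulS (C : 'M_n) (i j : 'I_n) : (C *m S) i j = (C *m s j) i 0.
  by rewrite !mxE; apply: eq_bigr => l _; rewrite mxE.
have gramE (i j : 'I_n) : (S^T *m N *m S) i j = ((s i)^T *m N *m s j) 0 0.
  rewrite mulS !mxE; apply: eq_bigr => l _; rewrite !mxE; congr (_ * _).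
  by apply: eq_bigr => m _; rewrite !mxE.
have S_unit : S \in unitmx.
  (* Conjugacy kills only the entries below the diagonal, so the Gram matrix is upper triangular;
     its transpose has the lower triangular shape that [det_trig] expects. *)
  suff: (S^T *m N *m S)^T \in unitmx.
    by rewrite unitmx_tr unitmx_mul => /andP[].
  rewrite unitmxE det_trig; last first.
    by apply/is_trig_mxP=> i j ltij; rewrite mxE gramE conj0 // ltij ltn_ord.
  rewrite unitfE prodf_seq_neq0; apply/allP=> i _.
  by rewrite mxE gramE diag_neq0.
by apply: (can_inj (mulmxK S_unit)); apply/matrixP=> i j; rewrite !mulS eqBA.
Qed.

(** Induction on [k] from [j.+1], where [secant] applies. The second hypothesis may assume the
    equation at step [k]: that is the induction hypothesis, and the symmetric updates use it to see
    that their correction vanishes on [s j]. *)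
Lemma hereditary_secant (F : fieldType) (n : nat) (A : 'M[F]_n)
    (B : nat -> 'M[F]_n) (s : nat -> 'cV[F]_n) (m : nat) :
    (forall k, (k < m)%N -> B k.+1 *m s k = A *m s k) ->
    (forall j k, (j < k < m)%N -> B k *m s j = A *m s j ->
       B k.+1 *m s j = B k *m s j) ->
  forall j k, (j < k <= m)%N -> B k *m s j = A *m s j.
Proof.
move=> secant keep j; elim=> [//|k IHk] /andP[]; rewrite ltnS leq_eqVlt.
case/predU1P=> [-> lt_km | lt_jk lt_km]; first exact: secant.
have eqk : B k *m s j = A *m s j by apply: IHk; rewrite lt_jk ltnW.
by rewrite keep // lt_jk.
Qed.

Section Updates.

Variables (R : realType) (n : nat).
Implicit Types (A B M W : 'M[R]_n) (s y u v x : 'cV[R]_n).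

Lemma dotWE W u v : dotW W u v = dot u (W *m v).
Proof. by rewrite /dotW /dot mulmxA. Qed.

Lemma dotC u v : dot u v = dot v u.
Proof. by rewrite /dot -[u^T *m v]trmxK [LHS]mxE trmx_mul trmxK. Qed.

Lemma dot_mull W u v : dot (W *m u) v = dot u (W^T *m v).
Proof. by rewrite /dot trmx_mul mulmxA. Qed.

Lemma dotDr u v x : dot u (v + x) = dot u v + dot u x.
Proof. by rewrite /dot mulmxDr mxE. Qed.

Lemma dotZr c u v : dot u (c *: v) = c * dot u v.
Proof. by rewrite /dot -scalemxAr mxE. Qed.

Lemma dotNr u v : dot u (- v) = - dot u v.
Proof. by rewrite /dot mulmxN mxE. Qed.

Lemma dot_gt0 u : u != 0 -> 0 < dot u u.
Proof.
move=> u_neq0; have sqrE i : u^T 0 i * u i 0 = u i 0 ^+ 2 by rewrite mxE expr2.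
rewrite /dot mxE lt_def sumr_ge0 => [|i _]; last by rewrite sqrE sqr_ge0.
rewrite andbT; apply: contraNneq u_neq0 => /eqP.
rewrite psumr_eq0 => [/allP u0|i _]; last by rewrite sqrE sqr_ge0.
apply/eqP/colP=> i; rewrite mxE; have := u0 i (mem_index_enum i).
by rewrite sqrE sqrf_eq0 => /eqP.
Qed.

Lemma mul_outer u v x : u *m v^T *m x = dot v x *: u.
Proof. by rewrite -mulmxA [v^T *m x]mx11_scalar mul_mx_scalar. Qed.

Lemma orthcomp_span_before W (s : nat -> 'cV[R]_n) j k z :
  (j < k)%N -> orthcomp W (span_before s k) z -> dotW W z (s j) = 0.
Proof.
move=> ltjk; apply; apply/memv_span/mapP; exists j => //.
by rewrite mem_iota.
Qed.

(** Isolates the two numbers [dot y x] and [dot s (B *m x)] through which every correction acts on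
    [x]; symmetry of [B] brings the pairing of [omega] with [x] to this form. *)
Lemma broyden_mul theta B s y x : B^T = B ->
  broyden_update theta B s y *m x =
    B *m x + (dot y x / dot s y) *: y
    - (dot s (B *m x) / dotW B s s) *: (B *m s)
    + (theta * (Num.sqrt (dotW B s s) *
        (dot y x / dot s y - dot s (B *m x) / dotW B s s)))
      *: omega B s y.
Proof.
move=> symB; rewrite /broyden_update; move wE: (omega B s y) => w.
have dotwx : dot w x = Num.sqrt (dotW B s s) *
    (dot y x / dot s y - dot s (B *m x) / dotW B s s).
  rewrite -wE (dotC _ x) /omega dotZr dotDr dotNr !dotZr ![_^-1 * _]mulrC.
  by rewrite (dotC x y) (dotC x) dot_mull symB.
rewrite !mulmxDl mulNmx -!scalemxAl !mul_outer -(mulmxA _ B x) mul_outer.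
by rewrite !scalerA ![_^-1 * _]mulrC dotwx.
Qed.

Lemma broyden_tr theta B s y : B^T = B ->
  (broyden_update theta B s y)^T = broyden_update theta B s y.
Proof.
move=> symB; rewrite /broyden_update; move: (omega B s y) => w.
rewrite !(linearD, linearN, linearZ) /=.
by rewrite !trmx_mul !trmxK symB !mulmxA.
Qed.

(** At [x = s] both quotients in [broyden_mul] equal 1, so [omega] is orthogonal to [s] and [theta]
    drops out. *)
Lemma broyden_secant theta B s y : B^T = B -> dot s y != 0 ->
  dotW B s s != 0 -> broyden_update theta B s y *m s = y.
Proof.
move=> symB sy_neq0 sBs_neq0; rewrite broyden_mul // (dotC y) -dotWE.
by rewrite !divff // subrr !mulr0 scale0r addr0 !scale1r addrAC subrr add0r.
Qed.

Lemma broyden_keep theta B s y x : B^T = B -> dot y x = 0 ->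
  dot s (B *m x) = 0 -> broyden_update theta B s y *m x = B *m x.
Proof.
move=> symB yx0 sBx0; rewrite broyden_mul // yx0 sBx0.
by rewrite !mul0r subrr !mulr0 !scale0r subr0 !addr0.
Qed.

Lemma invmx2_tr M : M^T = M -> (invmx2 M)^T = invmx2 M.
Proof. by move=> symM; rewrite trmx_mul trmx_inv symM. Qed.

(** By symmetry of [M] the form is the squared Euclidean norm of [invmx M *m s]. *)
Lemma invmx2_gt0 M s : M^T = M -> M \in unitmx -> s != 0 ->
  0 < dotW (invmx2 M) s s.
Proof.
move=> symM unitM s_neq0; rewrite dotWE -mulmxA.
rewrite -[invmx M]trmxK -dot_mull trmxK trmx_inv symM.
apply: dot_gt0; apply: contra_neq s_neq0 => Ms0.
by rewrite -[s](mulKVmx unitM) Ms0 mulmx0.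
Qed.

Lemma gpsb_mul M B s y x (N := invmx2 M) (r := y - B *m s) :
  gpsb_update M B s y *m x =
    B *m x
    + (dotW N s s)^-1 *: (dotW N s x *: r + dot r x *: (N *m s))
    - (dot s r / dotW N s s ^+ 2 * dotW N s x) *: (N *m s).
Proof.
rewrite /gpsb_update -/N -/r; clearbody r N.
rewrite !mulmxDl mulNmx -!scalemxAl mulmxDl -!(mulmxA _ N x) !mul_outer.
by rewrite -!dotWE scalerA.
Qed.

Lemma gpsb_tr M B s y : M^T = M -> B^T = B ->
  (gpsb_update M B s y)^T = gpsb_update M B s y.
Proof.
move=> /invmx2_tr symN symB; rewrite /gpsb_update.
move: (invmx2 M) symN (y - B *m s) => N symN r.
rewrite !(linearD, linearN, linearZ) /= !linearD /=.
by rewrite !trmx_mul !trmxK symN symB !mulmxA [X in B + X]addrC.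
Qed.

(** At [x = s] the middle term of [gpsb_mul] gives [r] plus a multiple of [N *m s], and the last
    term cancels exactly that multiple. *)
Lemma gpsb_secant M B s y : dotW (invmx2 M) s s != 0 ->
  gpsb_update M B s y *m s = y.
Proof.
move=> sNs_neq0; rewrite gpsb_mul scalerDr !scalerA mulVf // scale1r.
rewrite (dotC (y - _)) expr2 invfM mulrA mulfVK // [X in _ + X *: _]mulrC.
by rewrite addrA addrK addrCA subrr addr0.
Qed.

Lemma gpsb_keep M B s y x : dotW (invmx2 M) s x = 0 ->
  dot (y - B *m s) x = 0 -> gpsb_update M B s y *m x = B *m x.
Proof.
move=> sNx0 rx0; rewrite gpsb_mul sNx0 rx0.
by rewrite mulr0 !scale0r addr0 scaler0 subr0 addr0.
Qed.

(** The quotient is 1 at [x = s], which gives the secant equation, and 0 for [x] orthogonal to [s],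
    where nothing changes. *)
Lemma bgm_mul B s y x :
  bgm_update B s y *m x = B *m x + (dot s x / dot s s) *: (y - B *m s).
Proof.
by rewrite /bgm_update mulmxDl -scalemxAl mul_outer scalerA mulrC.
Qed.

End Updates.

Theorem proposition2p5 (R : realType) (n : nat) (A : 'M[R]_n)
    (B : nat -> 'M[R]_n) (s : nat -> 'cV[R]_n)
    (s_neq0 : forall k : nat, (k < n)%N -> s k != 0) :
  [/\ (* Broyden family *)
      forall theta : R,
        A \is symmetricmx -> B 0%N \is symmetricmx ->
        (forall k : nat, (k < n)%N ->
          [/\ dot (s k) (A *m s k) != 0,
              0 < dotW (B k) (s k) (s k)
            & B k.+1 = broyden_update theta (B k) (s k) (A *m s k)]) ->
        (spd A /\
         forall k : nat, (0 < k < n)%N -> orthcomp A (span_before s k) (s k))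
        \/
        (forall k : nat, (0 < k < n)%N ->
          spd (B k) /\ orthcomp (B k) (span_before s k) (s k)) ->
        B n = A,
      (* generalized PSB family *)
      forall M : 'M[R]_n,
        M \is symmetricmx -> M \in unitmx ->
        A \is symmetricmx -> B 0%N \is symmetricmx ->
        (forall k : nat, (k < n)%N ->
          B k.+1 = gpsb_update M (B k) (s k) (A *m s k)) ->
        (forall k : nat, (0 < k < n)%N ->
          orthcomp (invmx2 M) (span_before s k) (s k)) ->
        B n = A
    & (* Broyden's "good" method *)
      (forall k : nat, (k < n)%N ->
        B k.+1 = bgm_update (B k) (s k) (A *m s k)) ->
      (forall k : nat, (0 < k < n)%N ->
        orthcomp 1%:M (span_before s k) (s k)) ->
      B n = A].
Proof.
split.
- move=> theta /symmetricmx_tr symA /symmetricmx_tr symB0 upd conj.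
  have symB k : (k <= n)%N -> (B k)^T = B k.
    elim: k => [//|k IHk] lekn; case: (upd k lekn) => _ _ ->.
    by rewrite broyden_tr // IHk // ltnW.
  have secant k : (k < n)%N -> B k.+1 *m s k = A *m s k.
    move=> ltkn; case: (upd k ltkn) => sAs_neq0 /lt0r_neq0 sBs_neq0 ->.
    by rewrite broyden_secant ?symB // ltnW.
  have conjA j k : (j < k < n)%N -> B k *m s j = A *m s j ->
      dot (s k) (A *m s j) = 0.
    case/andP=> ltjk ltkn eqk.
    have k_in : (0 < k < n)%N by rewrite ltkn (leq_ltn_trans _ ltjk).
    case: conj => [[_ /(_ k k_in)]|/(_ k k_in)[_]];
      move/(orthcomp_span_before ltjk); rewrite dotWE //.
    by rewrite eqk.
  have keep j k : (j < k < n)%N -> B k *m s j = A *m s j ->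
      B k.+1 *m s j = B k *m s j.
    move=> jkn eqk; have sAs0 := conjA j k jkn eqk.
    case/andP: jkn => ltjk ltkn; case: (upd k ltkn) => _ _ ->.
    (* Both numbers to be annulled equal [dot (s k) (A *m s j)]: the first by symmetry of [A], the
       second by [eqk]. *)
    by apply: broyden_keep; rewrite ?symB 1?ltnW // ?dot_mull ?symA // eqk.
  have secants := hereditary_secant secant keep.
  apply: (@eq_mx_conjugate _ _ A _ _ s) => [j k jkn|k ltkn|k ltkn].
  + rewrite -[LHS]/(dotW A _ _) dotWE conjA // secants //.
    by case/andP: jkn => -> /ltnW.
  + by rewrite -[X in X != 0]/(dotW A _ _) dotWE; case: (upd k ltkn).
  + by rewrite secants // ltkn leqnn.
- move=> M /symmetricmx_tr symM unitM /symmetricmx_tr symA.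
  move=> /symmetricmx_tr symB0 upd conj.
  have symB k : (k <= n)%N -> (B k)^T = B k.
    elim: k => [//|k IHk] lekn.
    by rewrite upd // gpsb_tr // IHk // ltnW.
  have sNs_neq0 k : (k < n)%N -> dotW (invmx2 M) (s k) (s k) != 0.
    by move=> ltkn; rewrite lt0r_neq0 // invmx2_gt0 // s_neq0.
  have conjN j k : (j < k < n)%N -> dotW (invmx2 M) (s k) (s j) = 0.
    case/andP=> ltjk ltkn; apply: (orthcomp_span_before ltjk (conj k _)).
    by rewrite ltkn (leq_ltn_trans _ ltjk).
  have secant k : (k < n)%N -> B k.+1 *m s k = A *m s k.
    by move=> ltkn; rewrite upd // gpsb_secant ?sNs_neq0.
  have keep j k : (j < k < n)%N -> B k *m s j = A *m s j ->
      B k.+1 *m s j = B k *m s j.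
    move=> jkn eqk; have /andP[_ ltkn] := jkn.
    (* The residual is [(A - B k) *m s k]; by symmetry its product with [s j] moves [A - B k] onto
       [s j], where [eqk] makes it vanish. *)
    rewrite upd // gpsb_keep ?conjN // -mulmxBl dot_mull linearB /=.
    by rewrite symA symB 1?ltnW // mulmxBl eqk subrr /dot mulmx0 mxE.
  have secants := hereditary_secant secant keep.
  apply: (@eq_mx_conjugate _ _ (invmx2 M) _ _ s) => // k ltkn.
  by rewrite secants // ltkn leqnn.
- move=> upd conj.
  have conj1 j k : (j < k < n)%N -> dotW 1%:M (s k) (s j) = 0.
    case/andP=> ltjk ltkn; apply: (orthcomp_span_before ltjk (conj k _)).
    by rewrite ltkn (leq_ltn_trans _ ltjk).
  have ss_neq0 k : (k < n)%N -> dot (s k) (s k) != 0.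
    by move=> ltkn; rewrite lt0r_neq0 // dot_gt0 // s_neq0.
  have secant k : (k < n)%N -> B k.+1 *m s k = A *m s k.
    move=> ltkn; rewrite upd // bgm_mul divff ?ss_neq0 //.
    by rewrite scale1r addrC subrK.
  have keep j k : (j < k < n)%N -> B k *m s j = A *m s j ->
      B k.+1 *m s j = B k *m s j.
    move=> jkn _; have /andP[_ ltkn] := jkn; rewrite upd // bgm_mul.
    have := conj1 j k jkn; rewrite dotWE mul1mx => ->.
    by rewrite mul0r scale0r addr0.
  have secants := hereditary_secant secant keep.
  apply: (@eq_mx_conjugate _ _ 1%:M _ _ s) => // k ltkn.
    by rewrite -[X in X != 0]/(dotW 1%:M _ _) dotWE mul1mx ss_neq0.
  by rewrite secants // ltkn leqnn.
Qed.
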